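(* There exists a homeomorphism $f:[-1,1]^2\to[-1,1]^2$ with topological entropy $h_{top}(f)=0$ which is $(\omega,\alpha,\infty)$-sensitive, i.e. for every integer $n\ge 2$, $f$ is both $(\omega,n)$-sensitive and $(\alpha,n)$-sensitive.
   Context: $[-1,1]^2$ carries the Euclidean metric $d$. For sets $A,B$, $d(A,B)=\inf\{d(a,b):a\in A,b\in B\}$. For a homeomorphism $f$ of a compact metric space $X$ and $x\in X$, $\omega(x,f)$ is the set of points $y$ such that $f^{n_i}(x)\to y$ for some sequence of positive integers $n_1<n_2<\cdots$, and $\alpha(x,f)=\omega(x,f^{-1})$. For $n\ge 2$, $f$ is $(\omega,n)$-sensitive if there exists $s>0$ such that for every $x\in X$ and every neighborhood $U$ of $x$ there exist points $y_1,\dots,y_n\in U$ with $d(\omega(y_i,f),\omega(y_j,f))>s$ for all $i\ne j$; $f$ is $(\alpha,n)$-sensitive if $f^{-1}$ is $(\omega,n)$-sensitive. *)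

(* Defs.v *)
From Stdlib Require Import Reals List Arith.
From Coquelicot Require Import Coquelicot.
Open Scope R_scope.

Definition in_square (p : R * R) : Prop :=
  -1 <= fst p <= 1 /\ -1 <= snd p <= 1.

Definition dist2 (p q : R * R) : R :=
  sqrt ((fst p - fst q) ^ 2 + (snd p - snd q) ^ 2).

Definition cont_on_sq (f : R * R -> R * R) : Prop :=
  forall x, in_square x -> forall e, 0 < e -> exists d, 0 < d /\
    forall y, in_square y -> dist2 x y < d -> dist2 (f x) (f y) < e.

Definition homeo_sq (f g : R * R -> R * R) : Prop :=
  (forall x, in_square x -> in_square (f x)) /\ (forall x, in_square x -> in_square (g x)) /\
  (forall x, in_square x -> g (f x) = x) /\ (forall x, in_square x -> f (g x) = x) /\
  cont_on_sq f /\ cont_on_sq g.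

Definition set_dist (A B : R * R -> Prop) : Rbar :=
  Glb_Rbar (fun r => exists a b, A a /\ B b /\ r = dist2 a b).

Definition omega_set (f : R * R -> R * R) (x : R * R) (y : R * R) : Prop :=
  exists phi : nat -> nat, (1 <= phi 0)%nat /\
    (forall i, (phi i < phi (S i))%nat) /\
    forall e, 0 < e -> exists N, forall i, (N <= i)%nat ->
      dist2 (Nat.iter (phi i) f x) y < e.

Definition nbhd_sq (x : R * R) (U : R * R -> Prop) : Prop :=
  exists d, 0 < d /\ forall z, in_square z -> dist2 x z < d -> U z.

Definition omega_sensitive (f : R * R -> R * R) (n : nat) : Prop :=
  exists s, 0 < s /\
    forall x, in_square x -> forall U, nbhd_sq x U ->
      exists y : nat -> R * R,
        (forall i, (i < n)%nat -> in_square (y i) /\ U (y i)) /\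
        (forall i j, (i < n)%nat -> (j < n)%nat -> i <> j ->
           Rbar_lt (Finite s) (set_dist (omega_set f (y i)) (omega_set f (y j)))).

Definition alpha_sensitive (f g : R * R -> R * R) (n : nat) : Prop :=
  homeo_sq f g /\ omega_sensitive g n.

Definition separated (f : R * R -> R * R) (n : nat) (eps : R)
  (E : list (R * R)) : Prop :=
  NoDup E /\ List.Forall in_square E /\
  forall x y, In x E -> In y E -> x <> y ->
    exists i, (i < n)%nat /\ eps < dist2 (Nat.iter i f x) (Nat.iter i f y).

Definition sep_num (f : R * R -> R * R) (n : nat) (eps : R) : Rbar :=
  Rbar_lub (fun z => exists E, separated f n eps E /\ z = Finite (INR (length E))).

Definition Rbar_ln (x : Rbar) : Rbar :=
  match x with
  | Finite r => Finite (ln r)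
  | p_infty => p_infty
  | m_infty => m_infty
  end.

Definition Rbar_limsup (u : nat -> Rbar) : Rbar :=
  Rbar_glb (fun y => exists N, y = Rbar_lub (fun z => exists n, (N <= n)%nat /\ z = u n)).

(* (1/n) log s(n,eps), indexed by n+1 (n >= 1) *)
Definition sep_rate (f : R * R -> R * R) (eps : R) (n : nat) : Rbar :=
  Rbar_mult (Finite (/ INR (S n))) (Rbar_ln (sep_num f (S n) eps)).

(* h_top(f) = sup_{eps > 0} limsup_n (1/n) log s(n,eps)
   ( = lim_{eps -> 0}, since the quantity is monotone in eps ) *)
Definition top_entropy (f : R * R -> R * R) : Rbar :=
  Rbar_lub (fun z => exists eps, 0 < eps /\ z = Rbar_limsup (sep_rate f eps)).

(* Main.v *)
(** In the interior of the square use coordinates (s, u) in R^2, related to (x, y) by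
    x = s / (1 + |s|), y = u / (1 + |u|). There f is (s, u) |-> (s + 1, u + kick s), where
    kick s = sin (2 pi 2^j s) / 2^j with 2^j of the order of |s|; since kick tends to 0 at
    infinity, f extends to the closed square. The 2^j steps spent at octave j move u by
    sin (2 pi 2^j s) in total. For dyadic s these increments are eventually 0, so u converges;
    and replacing s by s + 1 / 2^M or s - 1 / 2^M with M large raises or lowers the limit of u
    by an amount between 1/2 and 7/2. Hence dyadic s close to any given point reach any finite
    list of targets up to an error 4, which separates the omega-limit sets. Since kick is odd
    about -1/2, the reflection x |-> - x conjugates f to its inverse, whence the same holds for
    the alpha-limit sets.

    The kicks are Hoelder continuous in x and the slides are Lipschitz with a constant quadratic in time,
    so the moduli of continuity of the iterates f^n degrade polynomially in n. Separated sets
    then have polynomial size, and the entropy vanishes. *)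

Require Import Defs.
From Stdlib Require Import Reals List Arith ZArith Lra Lia.
From Coquelicot Require Import Coquelicot.
Open Scope R_scope.

(** * Translations of the line, compactified to [-1,1] *)

(* Translation by [t] in the coordinate [chart y = y / (1 - |y|)]. Clearing denominators gives
   a formula that makes sense, and fixes [y], at the end points. *)
Definition slide (t y : R) : R :=
  (y + t * (1 - Rabs y)) / ((1 - Rabs y) + Rabs (y + t * (1 - Rabs y))).

(** With [q = 1 - |y|], the triangle inequality gives [|y| <= |y + t q| + |t| q]; adding [q] to both
    sides gives the claim. It bounds the inverse of the denominator by [1 + |t|]. *)
Lemma slide_denominator (t y : R) : Rabs y <= 1 ->
  1 <= (1 + Rabs t) * ((1 - Rabs y) + Rabs (y + t * (1 - Rabs y))).
Proof.
  intros Hy.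
  assert (H : Rabs y <= Rabs (y + t * (1 - Rabs y)) + Rabs t * (1 - Rabs y)).
  { replace (Rabs t * (1 - Rabs y)) with (Rabs (- (t * (1 - Rabs y)))).
    - replace y with ((y + t * (1 - Rabs y)) + - (t * (1 - Rabs y))) at 1 by ring.
      apply Rabs_triang.
    - rewrite Rabs_Ropp, Rabs_mult, (Rabs_pos_eq (1 - Rabs y)); lra. }
  pose proof (Rabs_pos t). pose proof (Rabs_pos (y + t * (1 - Rabs y))).
  nra.
Qed.

Lemma slide_denominator_pos (t y : R) : Rabs y <= 1 ->
  0 < (1 - Rabs y) + Rabs (y + t * (1 - Rabs y)).
Proof.
  intros Hy. pose proof (slide_denominator t y Hy). pose proof (Rabs_pos t). nra.
Qed.

Lemma Rabs_slide (t y : R) : Rabs y <= 1 ->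
  Rabs (slide t y) = 1 - (1 - Rabs y) / ((1 - Rabs y) + Rabs (y + t * (1 - Rabs y))).
Proof.
  intros Hy. pose proof (slide_denominator_pos t y Hy).
  unfold slide. rewrite Rabs_div by lra.
  rewrite (Rabs_pos_eq (_ + Rabs _)) by lra. field. lra.
Qed.

Lemma slide_bounded (t y : R) : Rabs y <= 1 -> Rabs (slide t y) <= 1.
Proof.
  intros Hy. pose proof (slide_denominator_pos t y Hy).
  rewrite Rabs_slide by easy.
  assert (0 <= (1 - Rabs y) / ((1 - Rabs y) + Rabs (y + t * (1 - Rabs y)))); [|lra].
  apply Rdiv_le_0_compat; lra.
Qed.

(** The pair [(y, 1 - |y|)] acts as homogeneous coordinates: by [Rabs_slide], [slide t] sends
    [(y, q)] to [(y + t q, q) / D]. The common factor [1 / D] cancels in the next slide. *)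
Lemma slide_add (s t y : R) : Rabs y <= 1 -> slide s (slide t y) = slide (s + t) y.
Proof.
  intros Hy. pose proof (slide_denominator_pos t y Hy) as HD.
  pose proof (slide_denominator_pos (s + t) y Hy) as HD'.
  unfold slide at 1. rewrite Rabs_slide by easy.
  unfold slide in *. set (q := 1 - Rabs y) in *.
  set (D := q + Rabs (y + t * q)) in *.
  replace (1 - (1 - q / D)) with (q / D) by ring.
  replace ((y + t * q) / D + s * (q / D)) with ((y + (s + t) * q) / D) by (field; lra).
  rewrite Rabs_div by lra. rewrite (Rabs_pos_eq D) by lra.
  field. split; [lra|].
  apply Rgt_not_eq. lra.
Qed.

Lemma slide_0 (y : R) : slide 0 y = y.
Proof.
  unfold slide. replace (y + 0 * (1 - Rabs y)) with y by ring. field. lra.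
Qed.

Lemma slide_opp (t y : R) : slide t (- y) = - slide (- t) y.
Proof.
  unfold slide. rewrite Rabs_Ropp.
  replace (- y + t * (1 - Rabs y)) with (- (y + - t * (1 - Rabs y))) by ring.
  rewrite Rabs_Ropp. unfold Rdiv. ring.
Qed.

Lemma slide_origin (t : R) : slide t 0 = t / (1 + Rabs t).
Proof.
  unfold slide. rewrite Rabs_R0. replace (0 + t * (1 - 0)) with t by ring. f_equal; ring.
Qed.

(** Since [|P' / D'| <= 1], only one of the two denominators remains in the bound. *)
Lemma quotient_close (P D P' D' : R) : 0 < D -> 0 < D' -> Rabs P' <= D' ->
  Rabs (P / D - P' / D') <= (Rabs (P - P') + Rabs (D - D')) / D.
Proof.
  intros HD HD' HP.
  replace (P / D - P' / D') with (((P - P') + (P' / D') * (D' - D)) / D)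
    by (field; lra).
  rewrite Rabs_div, (Rabs_pos_eq D) by lra.
  apply Rmult_le_compat_r; [left; apply Rinv_0_lt_compat; lra|].
  eapply Rle_trans; [apply Rabs_triang|]. apply Rplus_le_compat_l.
  rewrite Rabs_mult, (Rabs_minus_sym D' D).
  rewrite <- (Rmult_1_l (Rabs (D - D'))) at 2.
  apply Rmult_le_compat_r; [apply Rabs_pos|].
  rewrite Rabs_div, (Rabs_pos_eq D') by lra.
  apply Rle_div_l; lra.
Qed.

(** Numerators and denominators together differ by at most [(3 + 2 |t|) |y - z|]; dividing by the
    denominator costs another factor [1 + |t|], by [slide_denominator]. *)
Lemma slide_lipschitz_point (t y z : R) : Rabs y <= 1 -> Rabs z <= 1 ->
  Rabs (slide t y - slide t z) <= 3 * (1 + Rabs t) ^ 2 * Rabs (y - z).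
Proof.
  intros Hy Hz.
  pose proof (slide_denominator t y Hy) as H1.
  pose proof (slide_denominator_pos t y Hy) as HD.
  pose proof (slide_denominator_pos t z Hz) as HD'.
  eapply Rle_trans; [apply quotient_close; try easy; lra|].
  apply Rle_div_l; [easy|].
  assert (Hq : Rabs ((1 - Rabs y) - (1 - Rabs z)) <= Rabs (y - z)).
  { replace ((1 - Rabs y) - (1 - Rabs z)) with (- (Rabs y - Rabs z)) by ring.
    rewrite Rabs_Ropp. apply Rabs_triang_inv2. }
  set (q := 1 - Rabs y) in *. set (q' := 1 - Rabs z) in *.
  assert (HP : Rabs ((y + t * q) - (z + t * q')) <= (1 + Rabs t) * Rabs (y - z)).
  { replace ((y + t * q) - (z + t * q')) with ((y - z) + t * (q - q')) by ring.
    eapply Rle_trans; [apply Rabs_triang|]. rewrite Rabs_mult.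
    pose proof (Rabs_pos t). nra. }
  assert (HDD : Rabs ((q + Rabs (y + t * q)) - (q' + Rabs (z + t * q')))
                <= Rabs (y - z) + (1 + Rabs t) * Rabs (y - z)).
  { replace ((q + Rabs (y + t * q)) - (q' + Rabs (z + t * q')))
      with ((q - q') + (Rabs (y + t * q) - Rabs (z + t * q'))) by ring.
    eapply Rle_trans; [apply Rabs_triang|].
    pose proof (Rabs_triang_inv2 (y + t * q) (z + t * q')). lra. }
  set (D := q + Rabs (y + t * q)) in *.
  pose proof (Rabs_pos t). pose proof (Rabs_pos (y - z)).
  apply Rle_trans with (3 * (1 + Rabs t) * Rabs (y - z)); [nra|].
  replace (3 * (1 + Rabs t) ^ 2 * Rabs (y - z) * D)
    with (3 * (1 + Rabs t) * Rabs (y - z) * ((1 + Rabs t) * D)) by ring.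
  rewrite <- Rmult_1_r at 1. apply Rmult_le_compat_l; [|easy].
  repeat apply Rmult_le_pos; lra.
Qed.

(** Numerators and denominators each differ by at most [|t - t'| q] with [q = 1 - |y|], and the
    denominator is at least [q], so the constant depends neither on [y] nor on the times. *)
Lemma slide_lipschitz_time (t t' y : R) : Rabs y <= 1 ->
  Rabs (slide t y - slide t' y) <= 2 * Rabs (t - t').
Proof.
  intros Hy.
  pose proof (slide_denominator_pos t y Hy) as HD.
  pose proof (slide_denominator_pos t' y Hy) as HD'.
  eapply Rle_trans; [apply quotient_close; try easy; lra|].
  apply Rle_div_l; [easy|].
  set (q := 1 - Rabs y) in *.
  assert (HP : Rabs ((y + t * q) - (y + t' * q)) = Rabs (t - t') * q).
  { replace ((y + t * q) - (y + t' * q)) with ((t - t') * q) by ring.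
    rewrite Rabs_mult, (Rabs_pos_eq q); unfold q; lra. }
  assert (HDD : Rabs ((q + Rabs (y + t * q)) - (q + Rabs (y + t' * q)))
                <= Rabs (t - t') * q).
  { replace ((q + Rabs (y + t * q)) - (q + Rabs (y + t' * q)))
      with (Rabs (y + t * q) - Rabs (y + t' * q)) by ring.
    rewrite <- HP. apply Rabs_triang_inv2. }
  pose proof (Rabs_pos (y + t * q)). pose proof (Rabs_pos (t - t')).
  rewrite HP. nra.
Qed.

Definition chart (x : R) : R := x / (1 - Rabs x).

Lemma chart_slide (t x : R) : Rabs x < 1 -> chart (slide t x) = t + chart x.
Proof.
  intros Hx. pose proof (slide_denominator_pos t x (Rlt_le _ _ Hx)) as HD.
  unfold chart. rewrite Rabs_slide by lra. unfold slide.
  field. repeat split; lra.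
Qed.

Lemma chart_slide_origin (t : R) : chart (slide t 0) = t.
Proof.
  rewrite chart_slide by (rewrite Rabs_R0; lra).
  unfold chart. rewrite Rabs_R0. field.
Qed.

Lemma slide_chart (x : R) : Rabs x < 1 -> slide (chart x) 0 = x.
Proof.
  intros Hx. rewrite slide_origin. unfold chart.
  rewrite Rabs_div, (Rabs_pos_eq (1 - _)) by lra. field. lra.
Qed.

Lemma chart_opp (x : R) : chart (- x) = - chart x.
Proof. unfold chart. rewrite Rabs_Ropp. unfold Rdiv. ring. Qed.

Lemma one_plus_chart (x : R) : Rabs x < 1 -> 1 + Rabs (chart x) = / (1 - Rabs x).
Proof.
  intros Hx. unfold chart. rewrite Rabs_div, (Rabs_pos_eq (1 - _)) by lra. field. lra.
Qed.

(* Uses the convention [/ 0 = 0]. *)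
Lemma chart_endpoint (x : R) : Rabs x = 1 -> chart x = 0.
Proof.
  intros Hx. unfold chart, Rdiv. rewrite Hx, Rminus_diag, Rinv_0. ring.
Qed.

Lemma slide_endpoint (t x : R) : Rabs x = 1 -> slide t x = x.
Proof.
  intros Hx. unfold slide. rewrite Hx.
  replace (x + t * (1 - 1)) with x by ring. rewrite Hx. field.
Qed.

(** * The kicks *)

Lemma sin_lipschitz (x y : R) : Rabs (sin x - sin y) <= Rabs (x - y).
Proof.
  rewrite <- (Rmult_1_l (Rabs (x - y))).
  apply (bounded_variation sin cos). intros t _. split.
  - apply is_derive_Reals, derivable_pt_lim_sin.
  - apply Rabs_le, COS_bound.
Qed.

Lemma sin_period_Z (p : Z) (x : R) : sin (x + 2 * PI * IZR p) = sin x.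
Proof.
  destruct (Z_le_gt_dec 0 p).
  - rewrite <- (sin_period x (Z.to_nat p)), INR_IZR_INZ, Z2Nat.id by lia.
    f_equal. ring.
  - rewrite <- (sin_period _ (Z.to_nat (- p))), INR_IZR_INZ, Z2Nat.id by lia.
    f_equal. rewrite opp_IZR. ring.
Qed.

(* [up s] is the floor of [s] plus one, so octave [j] is where [|floor s + 1|] is in
   [2 ^ j, 2 ^ (j + 1)); this range is invariant under [s |-> - s - 1] off the integers. *)
Definition octave (s : R) : nat := Nat.log2 (Z.abs_nat (up s)).

Definition kick (s : R) : R := sin (2 * PI * 2 ^ octave s * s) / 2 ^ octave s.

Lemma two_pow_pos (n : nat) : 0 < 2 ^ n.
Proof. apply pow_lt. lra. Qed.

Lemma two_pow_ge_1 (n : nat) : 1 <= 2 ^ n.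
Proof. apply pow_R1_Rle. lra. Qed.

Lemma two_pow_IZR (n : nat) : 2 ^ n = IZR (Z.of_nat (2 ^ n)).
Proof. rewrite <- INR_IZR_INZ, pow_INR. reflexivity. Qed.

Lemma sin_pow2_integer (n : nat) (p : Z) : sin (2 * PI * 2 ^ n * IZR p) = 0.
Proof.
  rewrite <- sin_0, <- (sin_period_Z (Z.of_nat (2 ^ n) * p) 0).
  f_equal. rewrite mult_IZR, <- two_pow_IZR. ring.
Qed.

Lemma kick_le_octave (s : R) : Rabs (kick s) <= / 2 ^ octave s.
Proof.
  unfold kick. pose proof (two_pow_pos (octave s)).
  rewrite Rabs_div, (Rabs_pos_eq (2 ^ _)) by lra.
  unfold Rdiv. rewrite <- (Rmult_1_l (/ _)) at 2.
  apply Rmult_le_compat_r; [left; apply Rinv_0_lt_compat; lra|].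
  apply Rabs_le, SIN_bound.
Qed.

Lemma kick_le_1 (s : R) : Rabs (kick s) <= 1.
Proof.
  eapply Rle_trans; [apply kick_le_octave|].
  rewrite <- Rinv_1. apply Rinv_le_contravar; [lra|apply two_pow_ge_1].
Qed.

Lemma kick_decay (s : R) : Rabs (kick s) <= 4 / (1 + Rabs s).
Proof.
  eapply Rle_trans; [apply kick_le_octave|].
  pose proof (two_pow_pos (octave s)). pose proof (Rabs_pos s).
  assert (H1 : INR (Z.abs_nat (up s)) + 1 <= 2 * 2 ^ octave s).
  { change (2 * 2 ^ octave s) with (2 ^ S (octave s)).
    rewrite <- S_INR. replace 2 with (INR 2) by reflexivity.
    rewrite <- pow_INR. apply le_INR.
    (* [Nat.log2 0 = 0] places [up s = 0] in octave 0, outside the reach of [Nat.log2_spec]. *)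
    destruct (Nat.eq_dec (Z.abs_nat (up s)) 0) as [E|E].
    - rewrite E. pose proof (Nat.pow_nonzero 2 (S (octave s))). lia.
    - apply Nat.log2_spec. lia. }
  assert (H2 : Rabs s <= INR (Z.abs_nat (up s)) + 1).
  { rewrite INR_IZR_INZ, Zabs2Nat.id_abs, abs_IZR.
    destruct (archimed s). replace s with (IZR (up s) + (s - IZR (up s))) at 1 by ring.
    eapply Rle_trans; [apply Rabs_triang|]. apply Rplus_le_compat_l, Rabs_le. lra. }
  apply Rle_div_r; [lra|]. apply Rmult_le_reg_l with (2 ^ octave s); [easy|].
  rewrite <- Rmult_assoc, Rinv_r by lra. pose proof (two_pow_ge_1 (octave s)). lra.
Qed.

(** The amplitude [/ 2 ^ j] cancels the factor [2 ^ j] of the frequency, leaving [2 * PI <= 8]. *)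
Lemma octave_lipschitz (s x y : R) :
  Rabs (sin (2 * PI * 2 ^ octave s * x) / 2 ^ octave s
        - sin (2 * PI * 2 ^ octave s * y) / 2 ^ octave s) <= 8 * Rabs (x - y).
Proof.
  pose proof (two_pow_pos (octave s)).
  unfold Rdiv. rewrite <- Rmult_minus_distr_r. fold (Rdiv (sin (2 * PI * 2 ^ octave s * x)
    - sin (2 * PI * 2 ^ octave s * y)) (2 ^ octave s)).
  rewrite Rabs_div, (Rabs_pos_eq (2 ^ _)) by lra.
  apply Rle_div_l; [easy|]. eapply Rle_trans; [apply sin_lipschitz|].
  pose proof PI_4. pose proof PI_RGT_0.
  rewrite <- Rmult_minus_distr_l, Rabs_mult, (Rabs_pos_eq (2 * PI * _))
    by (apply Rmult_le_pos; lra).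
  pose proof (Rabs_pos (x - y)).
  assert (0 <= 2 ^ octave s * Rabs (x - y)) by (apply Rmult_le_pos; lra). nra.
Qed.

Lemma kick_near_integer (s : R) (p : Z) : Rabs (kick s) <= 8 * Rabs (s - IZR p).
Proof.
  pose proof (octave_lipschitz s s (IZR p)) as H.
  rewrite sin_pow2_integer in H. unfold Rdiv in H at 2.
  rewrite Rmult_0_l, Rminus_0_r in H. exact H.
Qed.

(** The octave changes only at integers, where every branch vanishes. If [up u < up v], the integer
    [up u] lies between [u] and [v], and both values are compared with 0 there. *)
Lemma kick_lipschitz (x y : R) : Rabs (kick x - kick y) <= 8 * Rabs (x - y).
Proof.
  assert (W : forall u v, u <= v -> Rabs (kick u - kick v) <= 8 * Rabs (u - v)).
  { intros u v Huv. destruct (Z.eq_dec (up u) (up v)) as [E|E].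
    - unfold kick. unfold octave at 3 4. rewrite <- E. apply octave_lipschitz.
    - destruct (archimed u), (archimed v).
      assert (up u < up v)%Z.
      { assert (up u <= up v)%Z; [|lia].
        apply Zlt_succ_le, lt_IZR. rewrite succ_IZR. lra. }
      assert (IZR (up u) <= IZR (up v) - 1) by (rewrite <- minus_IZR; apply IZR_le; lia).
      pose proof (kick_near_integer u (up u)) as Hu.
      pose proof (kick_near_integer v (up u)) as Hv.
      rewrite (Rabs_left1 (u - v)) by lra.
      rewrite (Rabs_left1 (u - _)) in Hu by lra.
      rewrite (Rabs_pos_eq (v - _)) in Hv by lra.
      unfold Rminus at 1. eapply Rle_trans; [apply Rabs_triang|].
      rewrite Rabs_Ropp. lra. }
  destruct (Rle_or_lt x y) as [H|H]; [now apply W|].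
  rewrite (Rabs_minus_sym (kick x)), (Rabs_minus_sym x). apply W. lra.
Qed.

Lemma kick_integer (p : Z) : kick (IZR p) = 0.
Proof. unfold kick. rewrite sin_pow2_integer. unfold Rdiv. ring. Qed.

Lemma up_eq (s : R) (z : Z) : IZR z - 1 <= s < IZR z -> up s = z.
Proof. intros H. symmetry. apply tech_up; lra. Qed.

(** Off the integers [up (- s) = - up (s - 1)], so both sides use the same octave, and the sine is
    odd with integer period. At an integer the octaves may differ, but both kicks vanish. *)
Lemma kick_reflect (s : R) : kick (- s) = - kick (s - 1).
Proof.
  destruct (archimed s) as [H1 H2].
  destruct (Req_dec s (IZR (up s) - 1)) as [E|E].
  - replace (- s) with (IZR (1 - up s)) by (rewrite minus_IZR; lra).
    replace (s - 1) with (IZR (up s - 2)) by (rewrite minus_IZR; lra).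
    rewrite !kick_integer. ring.
  - unfold kick.
    assert (Ho : octave (- s) = octave (s - 1)).
    { unfold octave. rewrite (up_eq (- s) (- (up s - 1))), (up_eq (s - 1) (up s - 1)).
      - f_equal. lia.
      - rewrite minus_IZR. lra.
      - rewrite opp_IZR, minus_IZR. lra. }
    rewrite Ho. set (j := octave (s - 1)).
    unfold Rdiv. rewrite Ropp_mult_distr_l, <- sin_neg. f_equal.
    rewrite <- (sin_period_Z (- Z.of_nat (2 ^ j)) (- _)), opp_IZR, <- two_pow_IZR. f_equal. ring.
Qed.

(** At the end points [chart] defaults to 0, where [kick] vanishes; this agrees with the limit of
    the kicks at infinity. *)
Definition shear (x : R) : R := kick (chart x).

Lemma shear_le_1 (x : R) : Rabs (shear x) <= 1.
Proof. apply kick_le_1. Qed.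

Lemma shear_endpoint (x : R) : Rabs x = 1 -> shear x = 0.
Proof. intros Hx. unfold shear. rewrite chart_endpoint by easy. apply (kick_integer 0). Qed.

Lemma shear_decay (x : R) : Rabs x <= 1 -> Rabs (shear x) <= 4 * (1 - Rabs x).
Proof.
  intros Hx. destruct (Req_dec (Rabs x) 1) as [E|E].
  - rewrite shear_endpoint by easy. rewrite E, Rabs_R0. lra.
  - unfold shear. eapply Rle_trans; [apply kick_decay|].
    rewrite one_plus_chart by lra. right. field. lra.
Qed.

(* Near the ends both values are small, elsewhere the chart expands by at most [/ eta ^ 2]. *)
Lemma shear_holder (x y eta : R) : Rabs x <= 1 -> Rabs y <= 1 -> 0 < eta <= 1 ->
  Rabs (x - y) <= eta ^ 3 -> Rabs (shear x - shear y) <= 12 * eta.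
Proof.
  intros Hx Hy He Hxy.
  pose proof (Rabs_triang_inv2 x y) as Hq.
  apply Rabs_le_between in Hq.
  assert (eta ^ 3 <= eta) by nra.
  destruct (Rle_or_lt (Rmin (1 - Rabs x) (1 - Rabs y)) eta) as [H1|H1].
  (* One gap is at most [eta] and the other at most [2 * eta], whence [4 * 3 = 12]. *)
  - assert ((1 - Rabs x) + (1 - Rabs y) <= 3 * eta)
      by (unfold Rmin in H1; destruct Rle_dec; lra).
    pose proof (shear_decay x Hx). pose proof (shear_decay y Hy).
    unfold Rminus at 1. eapply Rle_trans; [apply Rabs_triang|].
    rewrite Rabs_Ropp. lra.
  - assert (eta < 1 - Rabs x) by (eapply Rlt_le_trans; [apply H1|apply Rmin_l]).
    assert (eta < 1 - Rabs y) by (eapply Rlt_le_trans; [apply H1|apply Rmin_r]).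
    eapply Rle_trans; [apply kick_lipschitz|].
    assert (Rabs (chart x - chart y) <= eta); [|lra].
    unfold chart.
    replace (x / (1 - Rabs x) - y / (1 - Rabs y)) with
      (((x - y) * (1 - Rabs x) + x * (Rabs x - Rabs y)) / ((1 - Rabs x) * (1 - Rabs y)))
      by (field; lra).
    assert (HQ : eta * eta < (1 - Rabs x) * (1 - Rabs y)) by nra.
    rewrite Rabs_div by nra. rewrite (Rabs_pos_eq (_ * (1 - Rabs y))) by nra.
    apply Rle_div_l; [nra|]. eapply Rle_trans; [apply Rabs_triang|].
    rewrite !Rabs_mult, (Rabs_pos_eq (1 - Rabs x)) by lra.
    pose proof (Rabs_triang_inv2 x y). pose proof (Rabs_pos x).
    apply Rle_trans with (Rabs (x - y)); [nra|].
    apply Rle_trans with (eta * (eta * eta)); [lra|].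
    apply Rmult_le_compat_l; lra.
Qed.

(** In the chart, [- slide 1 x] is [- s - 1], the reflection about -1/2. This identity makes the
    conjugate by [flip] undo the vertical slide. *)
Lemma shear_reflect (x : R) : Rabs x <= 1 -> shear (- slide 1 x) = - shear x.
Proof.
  intros Hx. destruct (Req_dec (Rabs x) 1) as [E|E].
  - rewrite slide_endpoint by easy.
    rewrite !shear_endpoint; rewrite ?Rabs_Ropp; try easy. ring.
  - unfold shear. rewrite chart_opp, kick_reflect, chart_slide by lra.
    f_equal. f_equal. ring.
Qed.

(** * Sums of kicks along dyadic orbits *)

Fixpoint kicks (n : nat) (s : R) : R :=
  match n with O => 0 | S m => kicks m s + kick (s + INR m) end.

Lemma kicks_lipschitz (n : nat) (s t : R) :
  Rabs (kicks n s - kicks n t) <= INR n * (8 * Rabs (s - t)).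
Proof.
  induction n as [|n IH].
  - simpl. rewrite Rminus_0_r, Rabs_R0. lra.
  - rewrite S_INR. simpl kicks.
    pose proof (kick_lipschitz (s + INR n) (t + INR n)) as H.
    replace (s + INR n - (t + INR n)) with (s - t) in H by ring.
    replace (kicks n s + kick (s + INR n) - (kicks n t + kick (t + INR n)))
      with ((kicks n s - kicks n t) + (kick (s + INR n) - kick (t + INR n))) by ring.
    eapply Rle_trans; [apply Rabs_triang|]. lra.
Qed.

Lemma up_plus_INR (s : R) (n : nat) : up (s + INR n) = (up s + Z.of_nat n)%Z.
Proof.
  destruct (archimed s). apply up_eq. rewrite plus_IZR, <- INR_IZR_INZ. lra.
Qed.

(** The integer translation by [k] is a whole number of periods, so [k] matters only through the
    octave. *)
Lemma kick_at_octave (s : R) (k j : nat) :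
  Nat.log2 (Z.abs_nat (up s + Z.of_nat k)) = j ->
  kick (s + INR k) = sin (2 * PI * 2 ^ j * s) / 2 ^ j.
Proof.
  intros E. unfold kick, octave. rewrite up_plus_INR, E. f_equal.
  rewrite <- (sin_period_Z (Z.of_nat (2 ^ j) * Z.of_nat k) (_ * s)).
  f_equal. rewrite mult_IZR, <- two_pow_IZR, <- INR_IZR_INZ. ring.
Qed.

(** The orbit of [s] enters octave [j] on the positive side at time [k]. This depends on [s] only
    through [up s], so nearby points share the time. *)
Definition starts_octave (s : R) (j k : nat) : Prop :=
  (up s + Z.of_nat k = Z.of_nat (2 ^ j))%Z.

Lemma starts_octave_succ (s : R) (j k : nat) :
  starts_octave s j k -> starts_octave s (S j) (k + 2 ^ j).
Proof. unfold starts_octave. intros H. rewrite Nat.pow_succ_r'. lia. Qed.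

Lemma kicks_octave (s : R) (j k : nat) : starts_octave s j k ->
  kicks (k + 2 ^ j) s = kicks k s + sin (2 * PI * 2 ^ j * s).
Proof.
  unfold starts_octave. intros H.
  assert (P : forall i, (i <= 2 ^ j)%nat ->
    kicks (k + i) s = kicks k s + INR i * (sin (2 * PI * 2 ^ j * s) / 2 ^ j)).
  { induction i as [|i IH]; intros Hi.
    - rewrite Nat.add_0_r. simpl. ring.
    - rewrite Nat.add_succ_r. simpl kicks. rewrite IH by lia.
      rewrite (kick_at_octave s (k + i) j), S_INR; [ring|].
      replace (Z.abs_nat _) with (2 ^ j + i)%nat by lia.
      apply Nat.log2_unique; [lia|]. rewrite Nat.pow_succ_r'. lia. }
  rewrite P by lia. rewrite pow_INR. replace (INR 2) with 2 by reflexivity.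
  pose proof (two_pow_pos j). field. lra.
Qed.

Definition dyadic (m : nat) (s : R) : Prop := exists p : Z, 2 ^ m * s = IZR p.

Lemma sin_dyadic (m j : nat) (s : R) : dyadic m s -> (m <= j)%nat ->
  sin (2 * PI * 2 ^ j * s) = 0.
Proof.
  intros [p Hp] Hj. rewrite <- (sin_pow2_integer (j - m) p), <- Hp.
  f_equal. replace j with ((j - m) + m)%nat at 1 by lia. rewrite pow_add. ring.
Qed.

Lemma kicks_dyadic_const (s : R) (m k i : nat) :
  dyadic m s -> starts_octave s m k -> kicks (k + i) s = kicks k s.
Proof.
  intros Hd Hk. unfold starts_octave in Hk. induction i as [|i IH].
  - now rewrite Nat.add_0_r.
  - rewrite Nat.add_succ_r. simpl. rewrite IH, (kick_at_octave s (k + i) _ eq_refl).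
    rewrite (sin_dyadic m); [unfold Rdiv; ring|easy|].
    rewrite <- (Nat.log2_pow2 m) at 1 by lia. apply Nat.log2_le_mono. lia.
Qed.

(** Octave index and dyadic level coincide: by [kicks_dyadic_const] all kicks from time [k] on
    vanish, and [w] is the final displacement. *)
Definition settles (s w : R) : Prop :=
  exists m k, dyadic m s /\ starts_octave s m k /\ kicks k s = w.

(** Moving a dyadic point of level [m] by [/ 2 ^ (m + d)] produces this displacement over the
    octaves [m] to [m + e - 1]. *)
Fixpoint sine_sum (d e : nat) : R :=
  match e with O => 0 | S e => sine_sum d e + sin (2 * PI * 2 ^ e / 2 ^ d) end.

(** The angles double, so their sum stays below the next angle, and [0 <= sin x <= x] on the range
    considered. The alternative [d < e] ends that range and lets the induction run over all [e]. *)
Lemma sine_sum_small (d e : nat) :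
  0 <= sine_sum (S (S d)) e <= 2 * PI * 2 ^ e / 2 ^ S (S d) \/ (d < e)%nat.
Proof.
  pose proof PI_RGT_0. pose proof (two_pow_pos d).
  assert (HD : 2 ^ S (S d) = 4 * 2 ^ d) by (simpl; ring).
  rewrite HD. induction e as [|e IH].
  - left. simpl. split; [lra|]. apply Rdiv_le_0_compat; lra.
  - destruct IH as [IH|IH]; [|right; lia].
    destruct (Nat.le_gt_cases d e) as [E|E]; [right; lia|left].
    assert (H1 : 2 ^ e <= 2 ^ d) by (apply Rle_pow; [lra|lia]).
    pose proof (two_pow_pos e).
    simpl sine_sum. change (2 * (2 * 2 ^ d)) with (2 ^ S (S d)). rewrite HD.
    set (x := 2 * PI * 2 ^ e / (4 * 2 ^ d)) in *.
    assert (Hx : 0 < x) by (apply Rdiv_lt_0_compat; [apply Rmult_lt_0_compat|]; lra).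
    assert (Hx' : x <= PI).
    { apply Rle_div_l; [lra|]. assert (PI * 2 ^ e <= PI * 2 ^ d) by nra. nra. }
    pose proof (sin_ge_0 x (Rlt_le _ _ Hx) Hx'). pose proof (sin_lt_x x Hx).
    replace (2 * PI * 2 ^ S e / (4 * 2 ^ d)) with (2 * x); [lra|].
    unfold x. simpl. field. lra.
Qed.

(** The last two angles are [PI / 2] and [PI], contributing 1 and 0; the earlier terms add between 0
    and [PI / 2 <= 2]. *)
Lemma sine_sum_bounds (d : nat) : 1 <= sine_sum (S (S d)) (S (S d)) <= 3.
Proof.
  destruct (sine_sum_small d d) as [H|H]; [|lia].
  pose proof (two_pow_pos d). pose proof PI_4.
  simpl sine_sum.
  replace (2 * PI * (2 * 2 ^ d) / (2 * (2 * 2 ^ d))) with PI by (field; lra).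
  replace (2 * PI * 2 ^ d / (2 * (2 * 2 ^ d))) with (PI / 2) by (field; lra).
  rewrite sin_PI, sin_PI2.
  assert (2 * PI * 2 ^ d / 2 ^ S (S d) = PI / 2) as E by (simpl; field; lra).
  rewrite E in H. lra.
Qed.

Lemma sin_sign (sigma x : R) : sigma = 1 \/ sigma = -1 -> sin (sigma * x) = sigma * sin x.
Proof.
  intros [-> | ->].
  - now rewrite !Rmult_1_l.
  - replace (-1 * x) with (- x) by ring. rewrite sin_neg. ring.
Qed.

Lemma exists_small_pow2 (r : R) (d : nat) : 0 < r -> exists n, (d <= n)%nat /\ / 2 ^ n < r.
Proof.
  intros Hr.
  destruct (pow_lt_1_zero (/ 2)) with (y := r) as [N HN];
    [rewrite Rabs_pos_eq; lra|easy|].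
  exists (N + d)%nat. split; [lia|].
  specialize (HN (N + d)%nat ltac:(lia)). rewrite pow_inv in HN.
  rewrite Rabs_pos_eq in HN; [easy|]. left. apply Rinv_0_lt_compat, two_pow_pos.
Qed.

(* The octaves below the level of [s] feel the move by [/ 2 ^ M] only through the Lipschitz
   constant, while those between that level and [M] contribute the sines of 2 pi / 2 ^ i,
   whose sum is bounded away from 0. *)
Lemma settles_step (z : Z) (p q s w sigma : R) :
  (forall t, p < t < q -> up t = z) -> sigma = 1 \/ sigma = -1 ->
  p < s < q -> settles s w ->
  exists s' w', p < s' < q /\ settles s' w' /\ 1 / 2 <= sigma * (w' - w) <= 7 / 2.
Proof.
  intros Hz Hsg Hs (m & k & Hd & Hk & Hw).
  (* The last bound keeps the change of the first [k] kicks within 1/2, which widens the range from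
     1 to 3 of [sine_sum_bounds] to that from 1/2 to 7/2. *)
  set (c := Rmin (Rmin (s - p) (q - s)) (1 / 2 / (8 * INR k + 1))).
  pose proof (pos_INR k).
  assert (Hc : 0 < c).
  { unfold c. apply Rmin_glb_lt; [apply Rmin_glb_lt; lra|]. apply Rdiv_lt_0_compat; lra. }
  assert (Hc1 : c <= s - p) by (unfold c; eapply Rle_trans; [apply Rmin_l|apply Rmin_l]).
  assert (Hc2 : c <= q - s) by (unfold c; eapply Rle_trans; [apply Rmin_l|apply Rmin_r]).
  assert (Hc3 : INR k * (8 * c) <= 1 / 2).
  { assert (c * (8 * INR k + 1) <= 1 / 2); [|lra].
    apply Rle_div_r; [lra|]. unfold c. apply Rmin_r. }
  (* The margin 2 leaves room for the octaves with angles [PI / 2] and [PI]. *)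
  destruct (exists_small_pow2 c (m + 2) Hc) as (M & HM & HMc).
  assert (0 < / 2 ^ M) by apply Rinv_0_lt_compat, two_pow_pos.
  set (s' := s + sigma * / 2 ^ M).
  assert (Hss : Rabs (s' - s) = / 2 ^ M).
  { unfold s'. replace (s + sigma * / 2 ^ M - s) with (sigma * / 2 ^ M) by ring.
    destruct Hsg as [-> | ->].
    - rewrite Rmult_1_l. apply Rabs_pos_eq. lra.
    - replace (-1 * / 2 ^ M) with (- / 2 ^ M) by ring.
      rewrite Rabs_Ropp. apply Rabs_pos_eq. lra. }
  assert (Hs' : p < s' < q).
  { assert (Rabs (s' - s) < c) as Hlt by lra.
    apply Rabs_def2 in Hlt. lra. }
  destruct (Nat.le_exists_sub (m + 2) M HM) as (d & Ed & _).
  assert (EM : M = (m + S (S d))%nat) by lia. clear Ed HM. subst M.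
  (* [s] and [s'] have the same [up], hence enter octave [m] together; from there on
     [2 ^ (m + e) * s] is an integer, and only the perturbation is left in the sine. *)
  assert (HS : forall e, exists k', starts_octave s' (m + e) k' /\
            kicks k' s' = kicks k s' + sigma * sine_sum (S (S d)) e).
  { induction e as [|e (k' & IH1 & IH2)].
    - exists k. split; [|simpl; ring].
      unfold starts_octave in *. rewrite Nat.add_0_r, (Hz s'), <- (Hz s); easy.
    - exists (k' + 2 ^ (m + e))%nat. split.
      + rewrite Nat.add_succ_r. now apply starts_octave_succ.
      + rewrite kicks_octave, IH2 by easy. rewrite Rplus_assoc. f_equal.
        simpl sine_sum. rewrite Rmult_plus_distr_l. f_equal.
        rewrite <- sin_sign by easy.
        destruct Hd as [r Hr].
        rewrite <- (sin_period_Z (Z.of_nat (2 ^ e) * r) (sigma * _)). f_equal.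
        rewrite mult_IZR, <- Hr, <- two_pow_IZR. unfold s'.
        rewrite !pow_add. pose proof (two_pow_pos m). pose proof (two_pow_pos d).
        simpl. field. lra. }
  destruct (HS (S (S d))) as (k' & Hk' & Hw').
  exists s', (kicks k' s'). split; [easy|]. split.
  - exists (m + S (S d))%nat, k'. split; [|easy].
    destruct Hd as [r Hr].
    exists (Z.of_nat (2 ^ S (S d)) * r + (if Req_dec_T sigma 1 then 1 else -1))%Z.
    rewrite plus_IZR, mult_IZR, <- Hr, <- two_pow_IZR. unfold s'.
    pose proof (two_pow_pos (m + S (S d))).
    rewrite Rmult_plus_distr_l. f_equal.
    + rewrite pow_add. ring.
    + destruct Req_dec_T as [E|E]; destruct Hsg as [Hsg|Hsg];
        try (rewrite Hsg in *; lra); rewrite Hsg; field; lra.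
  - rewrite Hw', <- Hw.
    pose proof (sine_sum_bounds d). pose proof (kicks_lipschitz k s' s) as HL.
    rewrite Hss in HL.
    assert (INR k * (8 * / 2 ^ (m + S (S d))) <= INR k * (8 * c))
      by (apply Rmult_le_compat_l; lra).
    assert (HL' : Rabs (kicks k s' - kicks k s) <= 1 / 2) by lra.
    apply Rabs_le_between in HL'.
    destruct Hsg as [-> | ->]; lra.
Qed.

Lemma settles_exists (p q : R) : p < q -> exists s w, p < s < q /\ settles s w.
Proof.
  intros Hpq.
  (* Taking [m] at least [|up q|] ensures [up s <= 2 ^ m], so octave [m] starts at a nonnegative
     time. *)
  destruct (exists_small_pow2 (q - p) (Z.abs_nat (up q)) ltac:(lra)) as (m & Hm & Hr).
  pose proof (two_pow_pos m). destruct (archimed (p * 2 ^ m)) as [H1 H2].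
  set (s := IZR (up (p * 2 ^ m)) / 2 ^ m).
  assert (Hs : p < s < q).
  { unfold s. split; [apply Rlt_div_r; lra|].
    apply Rle_lt_trans with (p + / 2 ^ m); [|lra].
    apply Rle_div_l; [easy|]. rewrite Rmult_plus_distr_r, Rinv_l; lra. }
  assert (Hu : (up s <= Z.of_nat (2 ^ m))%Z).
  { assert (up s <= up q)%Z.
    { destruct (archimed s), (archimed q). apply Zlt_succ_le, lt_IZR.
      rewrite succ_IZR. lra. }
    pose proof (Nat.pow_gt_lin_r 2 m). lia. }
  exists s, (kicks (Z.to_nat (Z.of_nat (2 ^ m) - up s)) s). split; [easy|].
  exists m, (Z.to_nat (Z.of_nat (2 ^ m) - up s)). split; [|split; [|easy]].
  - exists (up (p * 2 ^ m)). unfold s. field. lra.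
  - unfold starts_octave. lia.
Qed.

Lemma settles_below (z : Z) (p q c : R) : p < q -> (forall t, p < t < q -> up t = z) ->
  exists s w, p < s < q /\ settles s w /\ w < c.
Proof.
  intros Hpq Hz. destruct (settles_exists p q Hpq) as (s0 & w0 & Hs0 & Hw0).
  assert (P : forall n, exists s w, p < s < q /\ settles s w /\ w <= w0 - INR n / 2).
  { induction n as [|n (s & w & Hs & Hw & Hle)].
    - exists s0, w0. simpl. repeat split; try easy. lra.
    - destruct (settles_step z p q s w (-1)) as (s' & w' & ? & ? & ?); try easy; [now right|].
      exists s', w'. rewrite S_INR. repeat split; try easy. lra. }
  destruct (INR_unbounded (2 * (w0 - c))) as [n Hn].
  destruct (P n) as (s & w & ? & ? & ?). exists s, w. repeat split; try easy. lra.
Qed.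

(** Starting below [c], upward moves between 1/2 and 7/2 must reach [c] and cannot jump over an
    interval of length 4. *)
Lemma settles_near (z : Z) (p q c : R) : p < q -> (forall t, p < t < q -> up t = z) ->
  exists s w, p < s < q /\ settles s w /\ c <= w <= c + 4.
Proof.
  intros Hpq Hz.
  destruct (settles_below z p q c Hpq Hz) as (s0 & w0 & Hs0 & Hw0 & Hc0).
  assert (P : forall n, exists s w, p < s < q /\ settles s w /\
    (c <= w <= c + 4 \/ w < c /\ w0 + INR n / 2 <= w)).
  { induction n as [|n (s & w & Hs & Hw & Hle)].
    - exists s0, w0. simpl. repeat split; try easy. right. lra.
    - destruct Hle as [Hle|Hle]; [exists s, w; tauto|].
      destruct (settles_step z p q s w 1) as (s' & w' & ? & ? & ?); try easy; [now left|].
      exists s', w'. rewrite S_INR. repeat split; try easy.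
      destruct (Rle_or_lt c w'); [left|right]; lra. }
  destruct (INR_unbounded (2 * (c - w0))) as [n Hn].
  destruct (P n) as (s & w & ? & ? & [?|?]); [|lra].
  exists s, w. repeat split; easy.
Qed.

(** * The homeomorphism *)

Lemma in_square_Rabs (p : R * R) : in_square p <-> Rabs (fst p) <= 1 /\ Rabs (snd p) <= 1.
Proof. unfold in_square. now rewrite !Rabs_le_between. Qed.

Lemma Rabs_fst_le_dist2 (p q : R * R) : Rabs (fst p - fst q) <= dist2 p q.
Proof.
  unfold dist2. rewrite <- sqrt_Rsqr_abs. apply sqrt_le_1_alt. unfold Rsqr.
  pose proof (pow2_ge_0 (snd p - snd q)). lra.
Qed.

Lemma Rabs_snd_le_dist2 (p q : R * R) : Rabs (snd p - snd q) <= dist2 p q.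
Proof.
  unfold dist2. rewrite <- sqrt_Rsqr_abs. apply sqrt_le_1_alt. unfold Rsqr.
  pose proof (pow2_ge_0 (fst p - fst q)). lra.
Qed.

Lemma dist2_le_sum (p q : R * R) :
  dist2 p q <= Rabs (fst p - fst q) + Rabs (snd p - snd q).
Proof.
  unfold dist2. set (a := fst p - fst q). set (b := snd p - snd q).
  pose proof (Rabs_pos a). pose proof (Rabs_pos b).
  rewrite <- (sqrt_pow2 (Rabs a + Rabs b)) by lra. apply sqrt_le_1_alt.
  rewrite <- (pow2_abs a), <- (pow2_abs b). nra.
Qed.

Definition drift_map (p : R * R) : R * R :=
  (slide 1 (fst p), slide (shear (fst p)) (snd p)).

Definition flip (p : R * R) : R * R := (- fst p, snd p).

(** Written as a conjugate, so that continuity and the control of limit sets carry over from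
    [drift_map]. *)
Definition drift_inv (p : R * R) : R * R := flip (drift_map (flip p)).

Lemma flip_flip (p : R * R) : flip (flip p) = p.
Proof. destruct p. unfold flip. simpl. now rewrite Ropp_involutive. Qed.

Lemma dist2_flip (p q : R * R) : dist2 (flip p) (flip q) = dist2 p q.
Proof. unfold dist2, flip. simpl. f_equal. ring. Qed.

Lemma in_square_flip (p : R * R) : in_square p -> in_square (flip p).
Proof. unfold in_square, flip. simpl. lra. Qed.

Lemma in_square_drift_map (p : R * R) : in_square p -> in_square (drift_map p).
Proof.
  rewrite !in_square_Rabs. intros [Hx Hy]. split; now apply slide_bounded.
Qed.

Lemma drift_inv_drift_map (p : R * R) : in_square p -> drift_inv (drift_map p) = p.
Proof.
  rewrite in_square_Rabs. destruct p as [x y]. intros [Hx Hy].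
  unfold drift_inv, flip, drift_map in *. simpl in *.
  rewrite slide_opp, Ropp_involutive, !slide_add, shear_reflect by easy.
  replace (- (1) + 1) with 0 by ring. replace (- shear x + shear x) with 0 by ring.
  now rewrite !slide_0.
Qed.

(** The counterpart of [kicks] on the compact interval, which also covers the end points. *)
Fixpoint drift (n : nat) (x : R) : R :=
  match n with O => 0 | S m => drift m x + shear (slide (INR m) x) end.

Lemma iter_drift_map (n : nat) (p : R * R) : in_square p ->
  Nat.iter n drift_map p = (slide (INR n) (fst p), slide (drift n (fst p)) (snd p)).
Proof.
  rewrite in_square_Rabs. intros [Hx Hy]. induction n as [|n IH].
  - simpl. rewrite !slide_0. now destruct p.
  - change (Nat.iter (S n) drift_map p) with (drift_map (Nat.iter n drift_map p)).
    rewrite IH, S_INR. unfold drift_map. simpl fst. simpl snd.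
    rewrite !slide_add by easy. f_equal; f_equal; simpl; ring.
Qed.

Lemma drift_slide_origin (n : nat) (s : R) : drift n (slide s 0) = kicks n s.
Proof.
  induction n as [|n IH]; [easy|]. simpl. rewrite IH. f_equal.
  unfold shear. rewrite slide_add, chart_slide_origin by (rewrite Rabs_R0; lra).
  f_equal. ring.
Qed.

Lemma drift_bound (n : nat) (x : R) : Rabs (drift n x) <= INR n.
Proof.
  induction n as [|n IH].
  - simpl. rewrite Rabs_R0. lra.
  - rewrite S_INR. simpl drift. eapply Rle_trans; [apply Rabs_triang|].
    pose proof (shear_le_1 (slide (INR n) x)). lra.
Qed.

Lemma slide_close (t y z eta r : R) : Rabs y <= 1 -> Rabs z <= 1 -> Rabs t <= r ->
  Rabs (y - z) <= eta / (3 * (1 + r) ^ 2) -> Rabs (slide t y - slide t z) <= eta.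
Proof.
  intros Hy Hz Ht H. pose proof (Rabs_pos t).
  eapply Rle_trans; [now apply slide_lipschitz_point|].
  assert (0 < 3 * (1 + r) ^ 2) by nra.
  apply Rle_div_r in H; [|easy].
  pose proof (Rabs_pos (y - z)).
  assert ((1 + Rabs t) ^ 2 <= (1 + r) ^ 2) by nra. nra.
Qed.

(** The hypothesis keeps the first coordinates within [eta ^ 3] up to time [n], so each step adds at
    most [12 * eta] by [shear_holder]. *)
Lemma drift_close (n k : nat) (x x' eta : R) : (k <= n)%nat -> 0 < eta <= 1 ->
  Rabs x <= 1 -> Rabs x' <= 1 -> Rabs (x - x') <= eta ^ 3 / (3 * (1 + INR n) ^ 2) ->
  Rabs (drift k x - drift k x') <= INR k * (12 * eta).
Proof.
  intros Hk He Hx Hx' H. induction k as [|k IH].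
  - simpl. rewrite Rminus_0_r, Rabs_R0. lra.
  - specialize (IH ltac:(lia)). rewrite S_INR. simpl drift.
    replace (drift k x + shear (slide (INR k) x) - (drift k x' + shear (slide (INR k) x')))
      with ((drift k x - drift k x') + (shear (slide (INR k) x) - shear (slide (INR k) x')))
      by ring.
    eapply Rle_trans; [apply Rabs_triang|].
    rewrite Rmult_plus_distr_r, Rmult_1_l. apply Rplus_le_compat; [easy|].
    apply shear_holder; try (now apply slide_bounded); [easy|].
    apply slide_close with (r := INR n); try easy.
    rewrite Rabs_pos_eq by apply pos_INR. apply le_INR. lia.
Qed.

(** Each of the two slides of nearby points costs at most [eta ^ 3 <= eta], and the difference of
    the drifts costs [24 * INR n * eta]. *)
Lemma iter_drift_map_close (n k : nat) (p q : R * R) (eta : R) :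
  (k <= n)%nat -> 0 < eta <= 1 -> in_square p -> in_square q ->
  Rabs (fst p - fst q) <= eta ^ 3 / (3 * (1 + INR n) ^ 2) ->
  Rabs (snd p - snd q) <= eta ^ 3 / (3 * (1 + INR n) ^ 2) ->
  dist2 (Nat.iter k drift_map p) (Nat.iter k drift_map q) <= 26 * (INR n + 1) * eta.
Proof.
  intros Hk He Hp Hq H1 H2. rewrite !iter_drift_map by easy.
  apply in_square_Rabs in Hp. apply in_square_Rabs in Hq.
  destruct p as [x y], q as [x' y']. simpl in *. destruct Hp as [Hx Hy], Hq as [Hx' Hy'].
  assert (Hkn : INR k <= INR n) by (apply le_INR; lia).
  pose proof (pos_INR k).
  assert (eta ^ 3 <= eta) by nra.
  eapply Rle_trans; [apply dist2_le_sum|]. simpl.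
  assert (Rabs (slide (INR k) x - slide (INR k) x') <= eta ^ 3).
  { apply slide_close with (r := INR n); try easy. rewrite Rabs_pos_eq; easy. }
  assert (Rabs (slide (drift k x) y - slide (drift k x') y) <= 2 * (INR k * (12 * eta))).
  { eapply Rle_trans; [now apply slide_lipschitz_time|].
    apply Rmult_le_compat_l; [lra|]. now apply drift_close with n. }
  assert (Rabs (slide (drift k x') y - slide (drift k x') y') <= eta ^ 3).
  { apply slide_close with (r := INR n); try easy.
    eapply Rle_trans; [apply drift_bound|easy]. }
  replace (slide (drift k x) y - slide (drift k x') y') with
    ((slide (drift k x) y - slide (drift k x') y)
     + (slide (drift k x') y - slide (drift k x') y')) by ring.
  pose proof (Rabs_triang (slide (drift k x) y - slide (drift k x') y)
                          (slide (drift k x') y - slide (drift k x') y')).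
  nra.
Qed.

Lemma cont_drift_map : cont_on_sq drift_map.
Proof.
  intros p Hp e He.
  (* At [n = 1] the estimate reads [52 * eta]; 53 makes the inequality strict. *)
  set (eta := Rmin 1 (e / 53)).
  assert (Heta : 0 < eta <= 1).
  { unfold eta. split; [apply Rmin_glb_lt; lra|apply Rmin_l]. }
  assert (eta <= e / 53) by apply Rmin_r.
  exists (eta ^ 3 / (3 * (1 + INR 1) ^ 2)). simpl INR. split.
  - apply Rdiv_lt_0_compat; [apply pow_lt|]; lra.
  - intros q Hq Hpq.
    apply Rle_lt_trans with (26 * (INR 1 + 1) * eta); [|simpl; lra].
    apply (iter_drift_map_close 1 1); try easy.
    + eapply Rle_trans; [apply Rabs_fst_le_dist2|]. simpl INR. lra.
    + eapply Rle_trans; [apply Rabs_snd_le_dist2|]. simpl INR. lra.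
Qed.

Lemma homeo_drift_map : homeo_sq drift_map drift_inv.
Proof.
  repeat split; try (now apply in_square_drift_map);
    try (now apply in_square_flip, in_square_drift_map, in_square_flip).
  - intros p Hp. now apply drift_inv_drift_map.
  - intros p Hp. rewrite <- (flip_flip p) at 2.
    rewrite <- (drift_inv_drift_map (flip p)) by now apply in_square_flip.
    unfold drift_inv. now rewrite !flip_flip.
  - exact cont_drift_map.
  - intros p Hp e He.
    destruct (cont_drift_map (flip p)) with e as (d & Hd & H);
      [now apply in_square_flip|easy|].
    exists d. split; [easy|]. intros q Hq Hpq. unfold drift_inv. rewrite dist2_flip.
    apply H; [now apply in_square_flip|]. now rewrite dist2_flip.
Qed.

(** * Entropy *)

(** [up] minus one is the floor. For positive [N] the indices on [[-1, 1]] run from 0 to [2 * N],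
    the last one only at [x = 1]. *)
Definition cell (N : nat) (x : R) : nat := Z.to_nat (up (INR N * (x + 1)) - 1).

Lemma cell_lt (N : nat) (x : R) : -1 <= x <= 1 -> (cell N x < 2 * N + 1)%nat.
Proof.
  intros Hx. pose proof (pos_INR N). destruct (archimed (INR N * (x + 1))).
  assert (up (INR N * (x + 1)) <= Z.of_nat (2 * N + 1))%Z.
  { apply le_IZR. rewrite <- INR_IZR_INZ, plus_INR, mult_INR. simpl. nra. }
  unfold cell. lia.
Qed.

Lemma cell_eq_close (N : nat) (x y : R) : (0 < N)%nat -> -1 <= x -> -1 <= y ->
  cell N x = cell N y -> Rabs (x - y) <= / INR N.
Proof.
  intros HN Hx Hy H. apply lt_0_INR in HN.
  destruct (archimed (INR N * (x + 1))), (archimed (INR N * (y + 1))).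
  assert (P : forall z, -1 <= z -> (0 < up (INR N * (z + 1)))%Z).
  { intros z Hz. apply lt_IZR. destruct (archimed (INR N * (z + 1))). nra. }
  pose proof (P x Hx). pose proof (P y Hy). unfold cell in H.
  assert (E : up (INR N * (x + 1)) = up (INR N * (y + 1))) by lia.
  rewrite E in *.
  rewrite <- Rmult_1_l. apply Rle_div_r; [easy|].
  rewrite <- (Rabs_pos_eq (INR N)) at 1 by lra. rewrite <- Rabs_mult.
  apply Rabs_le. lra.
Qed.

Lemma length_le_of_injective_code (E : list (R * R)) (code : R * R -> nat * nat) (K : nat) :
  NoDup E -> (forall p, In p E -> (fst (code p) < K)%nat /\ (snd (code p) < K)%nat) ->
  (forall p q, In p E -> In q E -> code p = code q -> p = q) ->
  (length E <= K * K)%nat.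
Proof.
  intros HE Hb Hinj.
  rewrite <- (length_map code E).
  replace (K * K)%nat with (length (list_prod (seq 0 K) (seq 0 K)))
    by now rewrite length_prod, length_seq.
  apply NoDup_incl_length.
  - apply NoDup_map_NoDup_ForallPairs; [|easy].
    intros p q Hp Hq. now apply Hinj.
  - intros c Hc. apply in_map_iff in Hc. destruct Hc as (p & <- & Hp).
    destruct (Hb p Hp). destruct (code p). apply in_prod; apply in_seq; simpl in *; lia.
Qed.

(** For [eta = 1 / (m (n + 1))] the radius in [iter_drift_map_close] is exactly [1 / N] with
    [N = 3 m^3 (n + 1)^5]. Two points in one box of that side stay within [26 / m <= eps] for [n]
    steps, so a separated set has at most one point per box. *)
Lemma separated_drift_map_length (n m : nat) (eps : R) (E : list (R * R)) :
  (0 < m)%nat -> 26 / INR m <= eps -> separated drift_map n eps E ->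
  (length E <= (2 * (3 * m ^ 3 * (n + 1) ^ 5) + 1) * (2 * (3 * m ^ 3 * (n + 1) ^ 5) + 1))%nat.
Proof.
  intros Hm Heps (Hnd & Hsq & Hsep). rewrite Forall_forall in Hsq.
  set (N := (3 * m ^ 3 * (n + 1) ^ 5)%nat).
  assert (HN : (0 < N)%nat).
  { pose proof (Nat.pow_nonzero m 3 ltac:(lia)).
    pose proof (Nat.pow_nonzero (n + 1) 5 ltac:(lia)).
    unfold N. apply Nat.mul_pos_pos; lia. }
  assert (HM : 1 <= INR m) by (apply (le_INR 1); lia).
  pose proof (pos_INR n) as Hn.
  set (eta := / (INR m * (INR n + 1))).
  assert (Heta : 0 < eta <= 1).
  { unfold eta. split; [apply Rinv_0_lt_compat; nra|].
    rewrite <- Rinv_1. apply Rinv_le_contravar; nra. }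
  assert (Hdelta : / INR N = eta ^ 3 / (3 * (1 + INR n) ^ 2)).
  { unfold N, eta. rewrite !mult_INR, !pow_INR, plus_INR.
    replace (INR 3) with 3 by (simpl; ring). replace (INR 1) with 1 by easy.
    field. lra. }
  apply length_le_of_injective_code with (fun p => (cell N (fst p), cell N (snd p))); [easy| |].
  - intros p Hp. destruct (Hsq p Hp). simpl fst. simpl snd. split; now apply cell_lt.
  - intros p q Hp Hq Hc. injection Hc as H1 H2.
    destruct (Hsq p Hp) as [[Hpx _] [Hpy _]], (Hsq q Hq) as [[Hqx _] [Hqy _]].
    apply cell_eq_close in H1; try easy. apply cell_eq_close in H2; try easy.
    rewrite Hdelta in H1, H2.
    destruct (Req_dec (fst p) (fst q)) as [E1|E1];
      [destruct (Req_dec (snd p) (snd q)) as [E2|E2];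
        [destruct p, q; simpl in *; now subst|]|];
      exfalso; (destruct (Hsep p q Hp Hq) as (i & Hi & Hlt); [congruence|];
      pose proof (iter_drift_map_close n i p q eta ltac:(lia) Heta (Hsq p Hp) (Hsq q Hq) H1 H2);
      assert (26 * (INR n + 1) * eta = 26 / INR m) by (unfold eta; field; lra); lra).
Qed.

Lemma Rbar_lub_correct (E : Rbar -> Prop) : Rbar_is_lub E (Rbar_lub E).
Proof. exact (proj2_sig (Rbar_ex_lub E)). Qed.

Lemma Rbar_glb_correct (E : Rbar -> Prop) : Rbar_is_glb E (Rbar_glb E).
Proof. exact (proj2_sig (Rbar_ex_glb E)). Qed.

(** The constant 9 absorbs the [+ 1] in [2 * N + 1]. The lower bound, from a singleton, makes the
    logarithm nonnegative. *)
Lemma sep_num_drift_map (n m : nat) (eps : R) : (0 < m)%nat -> 26 / INR m <= eps ->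
  exists r, sep_num drift_map n eps = Finite r /\
    1 <= r <= (9 * INR m ^ 3 * (INR n + 1) ^ 5) ^ 2.
Proof.
  intros Hm Heps.
  set (B := (9 * INR m ^ 3 * (INR n + 1) ^ 5) ^ 2).
  destruct (Rbar_lub_correct (fun z => exists E,
    separated drift_map n eps E /\ z = Finite (INR (length E)))) as [Hub Hlub].
  fold (sep_num drift_map n eps) in Hub, Hlub.
  assert (H1 : Rbar_le (Finite 1) (sep_num drift_map n eps)).
  { apply Hub. exists ((0, 0) :: nil). split; [|easy]. split; [|split].
    - constructor; [easy|constructor].
    - constructor; [|constructor]. unfold in_square. simpl. lra.
    - intros p q [<-|[]] [<-|[]] Hpq. now contradiction Hpq. }
  assert (H2 : Rbar_le (sep_num drift_map n eps) (Finite B)).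
  { apply Hlub. intros z (E & HE & ->).
    apply (separated_drift_map_length n m) in HE; [|easy|easy].
    apply le_INR in HE. simpl Rbar_le. eapply Rle_trans; [exact HE|].
    rewrite mult_INR, plus_INR, !mult_INR, !pow_INR, plus_INR.
    replace (INR 3) with 3 by (simpl; ring). replace (INR 1) with 1 by easy.
    replace (INR 2) with 2 by easy.
    assert (Ha : 1 <= INR m ^ 3) by (apply pow_R1_Rle, (le_INR 1); lia).
    assert (Hb : 1 <= (INR n + 1) ^ 5).
    { apply pow_R1_Rle. pose proof (pos_INR n). lra. }
    unfold B. set (a := INR m ^ 3) in *. set (b := (INR n + 1) ^ 5) in *.
    assert (1 <= a * b) by nra. nra. }
  destruct (sep_num drift_map n eps) as [r| |]; try easy.
  now exists r.
Qed.

Lemma sep_rate_drift_map (n m : nat) (eps : R) : (0 < m)%nat -> 26 / INR m <= eps ->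
  exists r, sep_rate drift_map eps n = Finite r /\
    0 <= r <= 4 * ln (9 * INR m ^ 3) * / (INR n + 2) + 20 * (ln (INR n + 2) / (INR n + 2)).
Proof.
  intros Hm Heps.
  destruct (sep_num_drift_map (S n) m eps Hm Heps) as (r & E & Hr).
  exists (/ INR (S n) * ln r). split; [unfold sep_rate; now rewrite E|].
  rewrite S_INR in *. pose proof (pos_INR n).
  replace (INR n + 1 + 1) with (INR n + 2) in Hr by ring.
  set (x := INR n + 2) in *.
  assert (Ha : 1 <= INR m ^ 3) by (apply pow_R1_Rle, (le_INR 1); lia).
  assert (Hx : 2 <= x) by (unfold x; lra).
  assert (Hx5 : 0 < x ^ 5) by (apply pow_lt; lra).
  assert (Hl : ln r <= 2 * (ln (9 * INR m ^ 3) + 5 * ln x)).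
  { eapply Rle_trans; [apply ln_le; [|apply Hr]; lra|].
    rewrite ln_pow by (apply Rmult_lt_0_compat; lra).
    rewrite ln_mult, ln_pow by lra. simpl INR. lra. }
  assert (0 <= ln r) by (rewrite <- ln_1; apply ln_le; lra).
  split.
  - apply Rmult_le_pos; [left; apply Rinv_0_lt_compat; lra|easy].
  (* [sep_rate] at [n] concerns [n + 1] steps and the count involves [n + 2]; trading [n + 1] for
     [n + 2] at the cost of a factor 2 exposes [ln x / x]. *)
  - assert (Hinv : / (INR n + 1) <= 2 * / x).
    { replace (2 * / x) with (/ (x / 2)) by (field; lra).
      apply Rinv_le_contravar; unfold x; lra. }
    eapply Rle_trans; [apply Rmult_le_compat_r; [easy|exact Hinv]|].
    assert (0 < / x) by (apply Rinv_0_lt_compat; lra).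
    unfold Rdiv. nra.
Qed.

Lemma log_rate_vanishes (c : R) :
  is_lim_seq (fun n => c * / (INR n + 2) + 20 * (ln (INR n + 2) / (INR n + 2))) 0.
Proof.
  assert (Hx : is_lim_seq (fun n => INR n + 2) p_infty).
  { eapply is_lim_seq_plus; [apply is_lim_seq_INR|apply is_lim_seq_const|easy]. }
  replace (Finite 0) with (Finite (c * 0 + 20 * 0)) by (f_equal; ring).
  apply is_lim_seq_plus'.
  - apply (is_lim_seq_scal_l _ c (Finite 0)).
    apply (is_lim_seq_inv _ p_infty); [exact Hx|easy].
  - apply (is_lim_seq_scal_l _ 20 (Finite 0)).
    apply (is_lim_comp_seq (fun y => ln y / y) _ p_infty);
      [apply is_lim_div_ln_p| |exact Hx].
    now exists O.
Qed.

Lemma Rbar_limsup_eq_0 (u : nat -> Rbar) : (forall n, Rbar_le (Finite 0) (u n)) ->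
  (forall e, 0 < e -> exists N, forall n, (N <= n)%nat -> Rbar_le (u n) (Finite e)) ->
  Rbar_limsup u = Finite 0.
Proof.
  intros Hpos Hsmall. unfold Rbar_limsup.
  match goal with |- Rbar_glb ?P = _ => destruct (Rbar_glb_correct P) as [Hlb Hglb];
    set (L := Rbar_glb P) in * end.
  assert (H0 : Rbar_le (Finite 0) L).
  { apply Hglb. intros y [N ->].
    match goal with |- Rbar_le _ (Rbar_lub ?Q) => destruct (Rbar_lub_correct Q) as [Hub _] end.
    eapply Rbar_le_trans; [apply (Hpos N)|]. apply Hub. now exists N. }
  assert (H1 : forall e, 0 < e -> Rbar_le L (Finite e)).
  { intros e He. destruct (Hsmall e He) as [N HN].
    eapply Rbar_le_trans; [apply Hlb; exists N; reflexivity|].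
    apply Rbar_lub_correct. intros z (n & Hn & ->). now apply HN. }
  destruct L as [r| |]; [|now specialize (H1 1 Rlt_0_1)|easy].
  f_equal. apply Rle_antisym; [|easy].
  apply le_epsilon. intros e He. rewrite Rplus_0_l. now apply H1.
Qed.

Lemma top_entropy_drift_map : top_entropy drift_map = Finite 0.
Proof.
  assert (Z : forall eps, 0 < eps -> Rbar_limsup (sep_rate drift_map eps) = Finite 0).
  { intros eps Heps.
    destruct (INR_unbounded (26 / eps)) as [m Hm].
    assert (Hm0 : 0 < INR m).
    { eapply Rlt_trans; [|exact Hm]. apply Rdiv_lt_0_compat; lra. }
    assert (26 / INR m <= eps).
    { apply Rle_div_l; [easy|]. apply Rlt_div_l in Hm; lra. }
    assert (Hm1 : (0 < m)%nat) by now apply INR_lt.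
    apply Rbar_limsup_eq_0.
    - intros n. destruct (sep_rate_drift_map n m eps) as (r & -> & Hr); easy.
    - intros e He.
      pose proof (log_rate_vanishes (4 * ln (9 * INR m ^ 3))) as HL.
      apply is_lim_seq_spec in HL. destruct (HL (mkposreal e He)) as [N HN].
      exists N. intros n Hn. specialize (HN n Hn). simpl pos in HN.
      rewrite Rminus_0_r in HN. apply Rabs_def2 in HN.
      destruct (sep_rate_drift_map n m eps) as (r & -> & Hr); [easy|easy|].
      simpl. lra. }
  unfold top_entropy.
  match goal with |- Rbar_lub ?P = _ => destruct (Rbar_lub_correct P) as [Hub Hlub] end.
  apply Rbar_le_antisym.
  - apply Hlub. intros z (eps & Heps & ->). rewrite Z by easy. apply Rbar_le_refl.
  - apply Hub. exists 1. split; [lra|]. symmetry. apply Z. lra.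
Qed.

(** * Limit sets *)

Lemma strictly_increasing_ge (phi : nat -> nat) :
  (forall i, (phi i < phi (S i))%nat) -> forall i, (i <= phi i)%nat.
Proof. intros H i. induction i as [|i IH]; [lia|]. specialize (H i). lia. Qed.

(** From time [k] on, the second coordinate of the orbit is constant; [phi (N + k) >= k] puts the
    chosen term of the subsequence in that range. *)
Lemma omega_drift_map_settles (s w v : R) (z : R * R) :
  settles s w -> omega_set drift_map (slide s 0, slide v 0) z -> snd z = slide (v + w) 0.
Proof.
  intros (m & k & Hd & Hk & Hw) (phi & _ & Hphi & Hlim).
  assert (H00 : Rabs 0 <= 1) by (rewrite Rabs_R0; lra).
  apply cond_eq. intros e He. destruct (Hlim e He) as [N HN].
  specialize (HN (N + k)%nat ltac:(lia)).
  pose proof (strictly_increasing_ge phi Hphi (N + k)) as Hge.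
  rewrite iter_drift_map in HN
    by (apply in_square_Rabs; split; now apply slide_bounded).
  simpl fst in HN. simpl snd in HN.
  rewrite drift_slide_origin in HN.
  replace (phi (N + k)%nat) with (k + (phi (N + k)%nat - k))%nat in HN by lia.
  rewrite (kicks_dyadic_const s m), Hw, (slide_add w), (Rplus_comm w) in HN by easy.
  rewrite Rabs_minus_sym. eapply Rle_lt_trans; [|exact HN].
  eapply Rle_trans; [|apply Rabs_snd_le_dist2]. simpl. lra.
Qed.

(** The gap 6 is the spacing 10 of the targets minus the error 4 of [settles_near]. *)
Lemma slide_origin_gap (M u v : R) : 0 <= u <= M -> 0 <= v <= M -> 6 <= Rabs (u - v) ->
  1 / (1 + M) ^ 2 < Rabs (slide u 0 - slide v 0).
Proof.
  intros Hu Hv H. rewrite !slide_origin, (Rabs_pos_eq u), (Rabs_pos_eq v) by lra.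
  replace (u / (1 + u) - v / (1 + v)) with ((u - v) / ((1 + u) * (1 + v))) by (field; lra).
  assert (Hp : 0 < (1 + u) * (1 + v)) by nra.
  assert (HM : (1 + u) * (1 + v) <= (1 + M) ^ 2).
  { simpl. rewrite Rmult_1_r. apply Rmult_le_compat; lra. }
  rewrite Rabs_div, (Rabs_pos_eq (_ * _)) by lra.
  apply Rlt_div_l; [lra|]. unfold Rdiv. rewrite Rmult_assoc.
  assert (1 <= / ((1 + u) * (1 + v)) * (1 + M) ^ 2).
  { rewrite Rmult_comm. apply (Rle_div_r _ _ _ Hp). lra. }
  nra.
Qed.

Lemma interior_approx (x d : R) : Rabs x <= 1 -> 0 < d ->
  exists x', Rabs x' < 1 /\ Rabs (x - x') < d.
Proof.
  intros Hx Hd. set (h := Rmin (1 / 2) (d / 2)).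
  assert (0 < h) by (apply Rmin_glb_lt; lra).
  assert (h <= 1 / 2) by apply Rmin_l. assert (h <= d / 2) by apply Rmin_r.
  exists ((1 - h) * x). pose proof (Rabs_pos x). split.
  - rewrite Rabs_mult, Rabs_pos_eq by lra. nra.
  - replace (x - (1 - h) * x) with (h * x) by ring.
    rewrite Rabs_mult, Rabs_pos_eq by lra. nra.
Qed.

Lemma finite_choice (T : Type) (t0 : T) (P : nat -> T -> Prop) (n : nat) :
  (forall i, exists t, P i t) -> exists h, forall i, (i < n)%nat -> P i (h i).
Proof.
  intros HP. induction n as [|n [h Hh]].
  - exists (fun _ => t0). lia.
  - destruct (HP n) as [t Ht].
    exists (fun i => if Nat.eq_dec i n then t else h i).
    intros i Hi. destruct Nat.eq_dec as [->|]; [easy|]. apply Hh. lia.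
Qed.

(** Omega-limit sets are separated through their second coordinate alone, which [flip] preserves; so
    the property passes from [drift_map] to its inverse. *)
Definition spreads (F : R * R -> R * R) (n : nat) : Prop :=
  exists r, 0 < r /\ forall p d, in_square p -> 0 < d ->
    exists (y : nat -> R * R) (v : nat -> R),
      (forall i, (i < n)%nat -> in_square (y i) /\ dist2 p (y i) < d /\
         forall z, omega_set F (y i) z -> snd z = v i) /\
      (forall i j, (i < n)%nat -> (j < n)%nat -> i <> j -> r < Rabs (v i - v j)).

Lemma spreads_omega_sensitive (F : R * R -> R * R) (n : nat) :
  spreads F n -> omega_sensitive F n.
Proof.
  intros (r & Hr & H). exists r. split; [easy|].
  intros p Hp U (d & Hd & HU). destruct (H p d Hp Hd) as (y & v & Hy & Hv).
  exists y. split.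
  - intros i Hi. destruct (Hy i Hi) as (? & ? & _). split; [easy|]. now apply HU.
  - intros i j Hi Hj Hij.
    apply Rbar_lt_le_trans with (Finite (Rabs (v i - v j))); [now apply Hv|].
    apply Glb_Rbar_correct. intros t (a & b & Ha & Hb & ->).
    destruct (Hy i Hi) as (_ & _ & Hi'), (Hy j Hj) as (_ & _ & Hj').
    rewrite <- (Hi' a Ha), <- (Hj' b Hb). apply Rabs_snd_le_dist2.
Qed.

Lemma spreads_drift_map (n : nat) : spreads drift_map n.
Proof.
  exists (1 / (1 + 10 * INR n) ^ 2). split.
  { pose proof (pos_INR n). apply Rdiv_lt_0_compat; [lra|]. apply pow_lt. lra. }
  intros [x y] d Hp Hd. apply in_square_Rabs in Hp. destruct Hp as [Hx Hy].
  simpl in Hx, Hy.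
  destruct (interior_approx x (d / 4) Hx ltac:(lra)) as (x' & Hx' & Hxx).
  destruct (interior_approx y (d / 4) Hy ltac:(lra)) as (y' & Hy' & Hyy).
  assert (H00 : Rabs 0 <= 1) by (rewrite Rabs_R0; lra).
  (* The cap [up s0] makes [up] constant between [s0] and [q]; [d / 8] is doubled by
     [slide_lipschitz_time], so the total distance stays below [3 * d / 4]. *)
  set (s0 := chart x'). set (q := Rmin (s0 + d / 8) (IZR (up s0))).
  destruct (archimed s0) as [Hu1 Hu2].
  assert (Hq : s0 < q) by (apply Rmin_glb_lt; lra).
  assert (Hq1 : q <= s0 + d / 8) by apply Rmin_l.
  assert (Hq2 : q <= IZR (up s0)) by apply Rmin_r.
  assert (Hup : forall t, s0 < t < q -> up t = up s0) by (intros t Ht; apply up_eq; lra).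
  destruct (finite_choice (R * R) (0, 0)
    (fun i c => s0 < fst c < q /\ settles (fst c) (snd c) /\
       10 * INR i <= chart y' + snd c <= 10 * INR i + 4) n) as [h Hh].
  { intros i.
    destruct (settles_near (up s0) s0 q (10 * INR i - chart y') Hq Hup)
      as (s & w & Hs & Hw & Hsw).
    exists (s, w). simpl. repeat split; try easy; lra. }
  exists (fun i => (slide (fst (h i)) 0, y')),
    (fun i => slide (chart y' + snd (h i)) 0). split.
  - intros i Hi. destruct (Hh i Hi) as (Hs & Hw & _). split; [|split].
    + apply in_square_Rabs. simpl. split; [now apply slide_bounded|lra].
    + eapply Rle_lt_trans; [apply dist2_le_sum|]. simpl.
      pose proof (slide_lipschitz_time s0 (fst (h i)) 0 H00) as HL.
      unfold s0 in HL at 1. rewrite slide_chart in HL by easy.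
      rewrite (Rabs_left (s0 - _)) in HL by lra.
      replace (x - slide (fst (h i)) 0) with ((x - x') + (x' - slide (fst (h i)) 0)) by ring.
      pose proof (Rabs_triang (x - x') (x' - slide (fst (h i)) 0)). lra.
    + intros z Hz. rewrite <- (slide_chart y') in Hz by easy.
      now apply omega_drift_map_settles with (fst (h i)).
  - assert (Hb : forall i, (i < n)%nat -> 0 <= 10 * INR i <= 10 * INR n - 10).
    { intros i Hi. pose proof (pos_INR i). apply Nat.le_succ_l, le_INR in Hi.
      rewrite S_INR in Hi. lra. }
    assert (W : forall i j, (i < j)%nat -> (j < n)%nat -> 1 / (1 + 10 * INR n) ^ 2 <
      Rabs (slide (chart y' + snd (h i)) 0 - slide (chart y' + snd (h j)) 0)).
    { intros i j Hij Hj.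
      destruct (Hh i ltac:(lia)) as (_ & _ & Hi1), (Hh j Hj) as (_ & _ & Hj1).
      pose proof (Hb i ltac:(lia)). pose proof (Hb j Hj).
      apply Nat.le_succ_l, le_INR in Hij. rewrite S_INR in Hij.
      apply slide_origin_gap; try lra. rewrite Rabs_left; lra. }
    intros i j Hi Hj Hij. destruct (Nat.lt_gt_cases i j) as [Hc _].
    destruct (Hc Hij) as [Hlt|Hlt]; [now apply W|].
    rewrite Rabs_minus_sym. now apply W.
Qed.

Lemma iter_drift_inv (n : nat) (p : R * R) :
  Nat.iter n drift_inv p = flip (Nat.iter n drift_map (flip p)).
Proof.
  induction n as [|n IH]; simpl; [now rewrite flip_flip|].
  rewrite IH. unfold drift_inv. now rewrite flip_flip.
Qed.

Lemma omega_drift_inv (p z : R * R) :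
  omega_set drift_inv p z -> omega_set drift_map (flip p) (flip z).
Proof.
  intros (phi & H0 & Hphi & Hlim). exists phi. split; [easy|]. split; [easy|].
  intros e He. destruct (Hlim e He) as [N HN]. exists N. intros i Hi.
  rewrite <- dist2_flip, flip_flip, <- iter_drift_inv. now apply HN.
Qed.

Lemma spreads_drift_inv (n : nat) : spreads drift_inv n.
Proof.
  destruct (spreads_drift_map n) as (r & Hr & H). exists r. split; [easy|].
  intros p d Hp Hd.
  destruct (H (flip p) d (in_square_flip p Hp) Hd) as (y & v & Hy & Hv).
  exists (fun i => flip (y i)), v. split; [|easy].
  intros i Hi. destruct (Hy i Hi) as (H1 & H2 & H3). split; [|split].
  - now apply in_square_flip.
  - now rewrite <- dist2_flip, flip_flip.
  - intros z Hz. apply omega_drift_inv in Hz. rewrite flip_flip in Hz. now apply H3 in Hz.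
Qed.

Theorem theorem1p3 :
  exists f g : R * R -> R * R,
    homeo_sq f g /\
    top_entropy f = Finite 0 /\
    (forall n : nat, (2 <= n)%nat ->
       omega_sensitive f n /\ alpha_sensitive f g n).
Proof.
  exists drift_map, drift_inv. split; [exact homeo_drift_map|].
  split; [exact top_entropy_drift_map|].
  intros n _. split; [|split; [exact homeo_drift_map|]];
    apply spreads_omega_sensitive; [apply spreads_drift_map|apply spreads_drift_inv].
Qed.
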